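(* Let $(Q,+,\cdot,\le)$ be an arbitrary ordered field and $n\ge 2$. Then: the relation $\lambda$ is not definable by an existential formula in $(Q^n,\tau)$; the relation $\lambda$ is not definable by an existential formula in $(Q^n,\sigma)$; the relation $\sigma$ is not definable by a universal formula in $(Q^n,\tau)$; and the relation $\tau$ is not definable by a universal formula in $(Q^n,\sigma)$.
   Context: For $p=(p_0,\dots,p_{n-1}),\,q=(q_0,\dots,q_{n-1})\in Q^n$: $p\,\tau\,q$ iff $(p_0-q_0)^2>\sum_{i=1}^{n-1}(p_i-q_i)^2$; $p\,\lambda\,q$ iff $(p_0-q_0)^2=\sum_{i=1}^{n-1}(p_i-q_i)^2$ and $p_0\neq q_0$; $p\,\sigma\,q$ iff $(p_0-q_0)^2<\sum_{i=1}^{n-1}(p_i-q_i)^2$. An existential (universal) formula is one of the form $\exists z_1\cdots\exists z_k\,\psi$ (resp. $\forall z_1\cdots\forall z_k\,\psi$) with $\psi$ quantifier-free, in the language with equality and one binary relation symbol interpreted as the given relation; definitions are without parameters. *)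

(* Defs.v *)
From HB Require Import structures.
From mathcomp Require Import all_boot all_order all_algebra.

Set Implicit Arguments.
Unset Strict Implicit.
Unset Printing Implicit Defensive.

Import Order.TTheory GRing.Theory Num.Theory.

(* First-order formulas with equality and one binary relation symbol, all of
   whose free variables are among the [m] variables ['I_m].  Under a quantifier
   variable [0] is the bound one and the others are shifted by one. *)
Inductive formula (m : nat) : Type :=
| FFalse
| FEq of 'I_m & 'I_m
| FRel of 'I_m & 'I_m
| FNot of formula m
| FAnd of formula m & formula m
| FOr of formula m & formula m
| FImp of formula m & formula m
| FExists of formula m.+1
| FForall of formula m.+1.

Arguments FFalse {m}.

Fixpoint holds (T : Type) (r : T -> T -> Prop) (m : nat) (f : formula m) :
    m.-tuple T -> Prop :=
  match f with
  | FFalse => fun _ => False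
  | FEq i j => fun e => tnth e i = tnth e j
  | FRel i j => fun e => r (tnth e i) (tnth e j)
  | FNot g => fun e => ~ holds r g e
  | FAnd g h => fun e => holds r g e /\ holds r h e
  | FOr g h => fun e => holds r g e \/ holds r h e
  | FImp g h => fun e => holds r g e -> holds r h e
  | FExists g => fun e => exists z : T, holds r g [tuple of z :: e]
  | FForall g => fun e => forall z : T, holds r g [tuple of z :: e]
  end.

Fixpoint quantifier_free (m : nat) (f : formula m) : bool :=
  match f with
  | FFalse | FEq _ _ | FRel _ _ => true
  | FNot g => quantifier_free g
  | FAnd g h | FOr g h | FImp g h => quantifier_free g && quantifier_free h
  | FExists _ | FForall _ => false
  end.

Fixpoint existential (m : nat) (f : formula m) : bool :=
  if f is FExists g then existential g else quantifier_free f.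

Fixpoint universal (m : nat) (f : formula m) : bool :=
  if f is FForall g then universal g else quantifier_free f.

(* Parameter-free: the only free variables are the two arguments of [s]. *)
Definition existentially_definable (T : Type) (r s : T -> T -> Prop) : Prop :=
  exists f : formula 2,
    existential f /\ forall p q : T, s p q <-> holds r f [tuple p; q].

Definition universally_definable (T : Type) (r s : T -> T -> Prop) : Prop :=
  exists f : formula 2,
    universal f /\ forall p q : T, s p q <-> holds r f [tuple p; q].

Local Open Scope ring_scope.

Definition time2 (Q : realFieldType) (d : nat) (p q : 'rV[Q]_d.+1) : Q :=
  (p 0 ord0 - q 0 ord0) ^+ 2.

Definition space2 (Q : realFieldType) (d : nat) (p q : 'rV[Q]_d.+1) : Q :=
  \sum_(i < d.+1 | i != ord0) (p 0 i - q 0 i) ^+ 2.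

Definition tau (Q : realFieldType) (d : nat) (p q : 'rV[Q]_d.+1) : Prop :=
  time2 p q > space2 p q.

Definition lambda (Q : realFieldType) (d : nat) (p q : 'rV[Q]_d.+1) : Prop :=
  time2 p q = space2 p q /\ p 0 ord0 <> q 0 ord0.

Definition sigma (Q : realFieldType) (d : nat) (p q : 'rV[Q]_d.+1) : Prop :=
  time2 p q < space2 p q.

(* Main.v *)
Require Import Defs.
From HB Require Import structures.
From mathcomp Require Import all_boot all_order all_algebra.
From mathcomp Require Import lra.

(** Multiplying the time coordinate by [c <> 0] is injective, fixes [space2] and
    multiplies [time2] by [c ^+ 2].  If [c] is close enough to 1, it preserves
    [tau] and [sigma] on any given finite set of points, whereas a [lambda] pair
    becomes a [sigma] pair if [c < 1] and a [tau] pair if [c > 1].  Taking the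
    finite set to contain the witnesses of an existential formula true of a
    [lambda] pair, the formula (over [tau] if [c < 1], over [sigma] if [c > 1])
    remains true of the image pair.  The universal cases are dual. *)

Set Implicit Arguments.
Unset Strict Implicit.
Unset Printing Implicit Defensive.

Import Order.TTheory GRing.Theory Num.Theory.

Local Open Scope ring_scope.

(** * Preservation of formulas by maps that respect [r] on a finite set only *)

Section Preservation.
Variables (T : eqType) (r : T -> T -> Prop).

(** Injectivity makes equality atoms invariant; [r] is controlled on [s] only, since how close to 1
    a dilation must be depends on the finitely many points considered. *)
Definition embeds_on (s : seq T) (h : T -> T) : Prop :=
  injective h /\ {in s &, forall x y, r x y <-> r (h x) (h y)}.

Lemma map_tuple_cons (h : T -> T) (m : nat) (z : T) (e : m.-tuple T) :
  map_tuple h [tuple of z :: e] = [tuple of h z :: map_tuple h e].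
Proof. exact/val_inj. Qed.

Lemma map_tuple_pair (h : T -> T) (p q : T) :
  map_tuple h [tuple p; q] = [tuple h p; h q].
Proof. exact/val_inj. Qed.

Lemma quantifier_free_embed (m : nat) (f : formula m) (e : m.-tuple T)
    (h : T -> T) : quantifier_free f -> embeds_on e h ->
  holds r f e <-> holds r f (map_tuple h e).
Proof.
move=> qf eh; elim: f e qf eh => //= {m}.
- by move=> m i j e _ [hi _]; rewrite !tnth_map; split=> [->|/hi].
- by move=> m i j e _ [_ hr]; rewrite !tnth_map; apply: hr; apply: mem_tnth.
- by move=> m g IH e qf eh; have := IH e qf eh; tauto.
- by move=> m g IHg k IHk e /andP[qg qk] eh;
    have := IHg e qg eh; have := IHk e qk eh; tauto.
- by move=> m g IHg k IHk e /andP[qg qk] eh;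
    have := IHg e qg eh; have := IHk e qk eh; tauto.
- by move=> m g IHg k IHk e /andP[qg qk] eh;
    have := IHg e qg eh; have := IHk e qk eh; tauto.
Qed.

(** The set [s] collects the entries of [e] and the chosen witnesses, so it is fixed before [h]; the
    images under [h] of the witnesses are witnesses for the image tuple. *)
Lemma existential_embed (m : nat) (f : formula m) (e : m.-tuple T) :
  existential f -> holds r f e ->
  exists s : seq T, forall h, embeds_on s h -> holds r f (map_tuple h e).
Proof.
have base k (g : formula k) (e' : k.-tuple T) : quantifier_free g ->
    holds r g e' ->
    exists s : seq T, forall h, embeds_on s h -> holds r g (map_tuple h e').
  by move=> qf ge; exists e' => h eh; apply: (quantifier_free_embed qf eh).1.
elim: f e => {m} [m|m i j|m i j|m g _|m g _ k _|m g _ k _|m g _ k _|m g IH|m g _] e;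
  try exact: base.
move=> ex [z gz]; have [s sP] := IH _ ex gz.
by exists s => h /sP gh; exists (h z); rewrite -map_tuple_cons.
Qed.

(** To check a value [z] of the bound variable, the formula at the image tuple is instantiated at
    [h z]. The dual is proved directly, without negating formulas classically. *)
Lemma universal_embed (m : nat) (f : formula m) (e : m.-tuple T) :
  universal f ->
  (forall s : seq T, exists2 h, embeds_on s h & holds r f (map_tuple h e)) ->
  holds r f e.
Proof.
have base k (g : formula k) (e' : k.-tuple T) : quantifier_free g ->
    (forall s, exists2 h, embeds_on s h & holds r g (map_tuple h e')) ->
    holds r g e'.
  by move=> qf /(_ e')[h eh gh]; apply/(quantifier_free_embed qf eh).
elim: f e => {m} [m|m i j|m i j|m g _|m g _ k _|m g _ k _|m g _ k _|m g _|m g IH] e;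
  try exact: base.
move=> un H z; apply: IH => // s; have [h eh gh] := H s.
by exists h; rewrite // map_tuple_cons; apply: gh.
Qed.

Lemma not_existentially_definable (s : T -> T -> Prop) (p q : T) :
  s p q ->
  (forall l : seq T, exists2 h, embeds_on l h & ~ s (h p) (h q)) ->
  ~ existentially_definable r s.
Proof.
move=> spq H [f [ex fP]]; have [l lP] := existential_embed ex ((fP p q).1 spq).
by have [h /lP] := H l; rewrite map_tuple_pair => /fP.
Qed.

Lemma not_universally_definable (s : T -> T -> Prop) (p q : T) :
  ~ s p q ->
  (forall l : seq T, exists2 h, embeds_on l h & s (h p) (h q)) ->
  ~ universally_definable r s.
Proof.
move=> nspq H [f [un fP]]; apply/nspq/fP/universal_embed => // l.
by have [h lh /fP sh] := H l; exists h; rewrite ?map_tuple_pair.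
Qed.

End Preservation.

(** * Dilations of the time coordinate *)

Section TimeDilation.
Variables (Q : realFieldType) (d : nat).
Implicit Types (p q : 'rV[Q]_d.+1) (c : Q).

Definition dilate c p : 'rV[Q]_d.+1 :=
  \row_j (if j == ord0 then c * p 0 j else p 0 j).

Lemma dilate_inj c : c != 0 -> injective (dilate c).
Proof.
move=> c0 p q /rowP pq; apply/rowP => j; have := pq j; rewrite !mxE.
by case: ifP => // _ /(mulfI c0).
Qed.

Lemma time2_dilate c p q :
  time2 (dilate c p) (dilate c q) = c ^+ 2 * time2 p q.
Proof. by rewrite /time2 !mxE eqxx -mulrBr exprMn. Qed.

Lemma space2_dilate c p q : space2 (dilate c p) (dilate c q) = space2 p q.
Proof. by apply: eq_bigr => j /negPf j0; rewrite !mxE j0. Qed.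

Lemma time2_ge0 p q : 0 <= time2 p q.
Proof. exact: sqr_ge0. Qed.

Lemma lambda_time2_gt0 p q : lambda p q -> 0 < time2 p q.
Proof.
by case=> _ /eqP pq; rewrite /time2 lt_def sqr_ge0 sqrf_eq0 subr_eq0 pq.
Qed.

Lemma exists_lambda : (0 < d)%N -> exists p q, lambda p q.
Proof.
move=> d0; have i1 : (1 < d.+1)%N by [].
(* The pair is the origin and [(1, 1, 0, ..., 0)]. *)
exists 0, (\row_j (j <= 1)%N%:R); split; last first.
  by rewrite !mxE => /eqP; rewrite eq_sym oner_eq0.
rewrite /time2 /space2 (bigD1 (Ordinal i1)) //= big1 => [|j /andP[j0 j1]].
  by rewrite !mxE addr0.
rewrite !mxE; case: j j0 j1 => [[|[|j]] jd] //= _ _.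
by rewrite subrr expr0n.
Qed.

(** If [e <= 1], then [c ^+ 2] differs from 1 by at most [2 * e + e ^+ 2 <= 3 * e], so [t] moves by
    at most [3 * e * t]; it suffices that this be less than the gap between [t] and [s]. *)
Lemma dilate_strict1 p q : exists2 e : Q, 0 < e & forall c, `|c - 1| <= e ->
  (tau p q -> tau (dilate c p) (dilate c q)) /\
  (sigma p q -> sigma (dilate c p) (dilate c q)).
Proof.
rewrite /tau /sigma; have t0 := time2_ge0 p q.
set t := time2 p q in t0 *; set s := space2 p q.
have [st|st] := eqVneq s t.
  by exists 1 => // c _; rewrite st ltxx; split.
have g0 : 0 < `|t - s| by rewrite normr_gt0 subr_eq0 eq_sym.
have D0 : 0 < 3 * t + 3 + `|t - s| by lra.
(* In the denominator, [3 * t] serves to get [3 * e * t] below the gap, and the gap itself to get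
   [e <= 1]. *)
pose e := `|t - s| / (3 * t + 3 + `|t - s|).
have e0 : 0 < e by exact: divr_gt0.
have eE : e * (3 * t + 3 + `|t - s|) = `|t - s| by rewrite divfK ?gt_eqF.
have e1 : e <= 1 by rewrite ler_pdivrMr // mul1r; lra.
have e3t : 3 * e * t < `|t - s| by rewrite -eE; nra.
exists e => // c; rewrite ler_distl => /andP[c1 c2].
rewrite time2_dilate space2_dilate -/t -/s.
have lo : (1 - 3 * e) * t <= c ^+ 2 * t by apply: ler_wpM2r => //; nra.
have hi : c ^+ 2 * t <= (1 + 3 * e) * t by apply: ler_wpM2r => //; nra.
split=> [lt|lt]; [move: e3t; rewrite gtr0_norm ?subr_gt0 //|
  move: e3t; rewrite ltr0_norm ?subr_lt0 //]; lra.
Qed.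

Lemma near1_all (A : eqType) (l : seq A) (G : A -> Q -> Prop) :
  (forall a, exists2 e : Q, 0 < e & forall c, `|c - 1| <= e -> G a c) ->
  exists2 e : Q, 0 < e & forall c, `|c - 1| <= e -> {in l, forall a, G a c}.
Proof.
move=> H; elim: l => [|a l [e e0 eP]]; first by exists 1.
have [e' e'0 e'P] := H a; exists (Num.min e e'); first by rewrite lt_min e0.
move=> c; rewrite le_min => /andP[ce ce'] b; rewrite inE => /orP[/eqP->|bl].
  exact: e'P.
exact: eP bl.
Qed.

Lemma dilate_strict (l : seq 'rV[Q]_d.+1) :
  exists2 e : Q, 0 < e < 1 & forall c, `|c - 1| <= e ->
  {in l &, forall p q, (tau p q -> tau (dilate c p) (dilate c q)) /\
    (sigma p q -> sigma (dilate c p) (dilate c q))}.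
Proof.
have [e e0 eP] := near1_all [seq (p, q) | p <- l, q <- l]
  (fun a => dilate_strict1 a.1 a.2).
(* The cap at one half keeps [1 - e] positive, hence the contraction injective. *)
exists (Num.min e 2^-1); first by rewrite lt_min gt_min e0 /=; lra.
move=> c; rewrite le_min => /andP[/eP cP _] p q pl ql.
by apply: (cP (p, q)); apply/allpairsP; exists (p, q).
Qed.

(** Closeness to 1 preserves [tau] forwards. Backwards, a factor below 1 never increases [time2], so
    it creates no new [tau] pair, even from a [lambda] pair in [l]. *)
Lemma lambda_embed_tau (p q : 'rV[Q]_d.+1) (l : seq 'rV[Q]_d.+1) : lambda p q ->
  exists2 h, embeds_on (@tau Q d) l h & sigma (h p) (h q).
Proof.
move=> pq; have [e /andP[e0 e1] eP] := dilate_strict l.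
have c2 : (1 - e) ^+ 2 < 1 by nra.
exists (dilate (1 - e)).
  split; first by apply: dilate_inj; lra.
  move=> x y xl yl; split.
    by apply: (eP _ _ x y xl yl).1; rewrite addrAC subrr add0r normrN gtr0_norm.
  rewrite /tau time2_dilate space2_dilate => /lt_le_trans; apply.
  by rewrite ler_piMl ?time2_ge0 // ltW.
have := lambda_time2_gt0 pq.
by rewrite /sigma time2_dilate space2_dilate -pq.1 => t0; rewrite gtr_pMl.
Qed.

(** A factor above 1 never decreases [time2], so it creates no new [sigma] pair. *)
Lemma lambda_embed_sigma (p q : 'rV[Q]_d.+1) (l : seq 'rV[Q]_d.+1) :
  lambda p q -> exists2 h, embeds_on (@sigma Q d) l h & tau (h p) (h q).
Proof.
move=> pq; have [e /andP[e0 e1] eP] := dilate_strict l.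
have c2 : 1 < (1 + e) ^+ 2 by nra.
exists (dilate (1 + e)).
  split; first by apply: dilate_inj; lra.
  move=> x y xl yl; split.
    by apply: (eP _ _ x y xl yl).2; rewrite addrAC subrr add0r gtr0_norm.
  rewrite /sigma time2_dilate space2_dilate; apply: le_lt_trans.
  by rewrite ler_peMl ?time2_ge0 // ltW.
have := lambda_time2_gt0 pq.
by rewrite /tau time2_dilate space2_dilate -pq.1 => t0; rewrite ltr_pMl.
Qed.

End TimeDilation.

(* The dimension is d.+1, so that d >= 1 says that it is at least 2. *)
Theorem theorem4p11 (Q : realFieldType) (d : nat) (hd : (2 <= d.+1)%N) :
  [/\ ~ existentially_definable (@tau Q d) (@lambda Q d),
      ~ existentially_definable (@sigma Q d) (@lambda Q d),
      ~ universally_definable (@tau Q d) (@sigma Q d)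
    & ~ universally_definable (@sigma Q d) (@tau Q d)].
Proof.
have [p [q pq]] := exists_lambda Q hd.
split.
- apply: (not_existentially_definable pq) => l.
  have [h lh hpq] := lambda_embed_tau l pq; exists h => // -[E _].
  by move: hpq; rewrite /sigma E ltxx.
- apply: (not_existentially_definable pq) => l.
  have [h lh hpq] := lambda_embed_sigma l pq; exists h => // -[E _].
  by move: hpq; rewrite /tau E ltxx.
(* The same [lambda] pair serves here as a pair outside [sigma] that is moved into [sigma], and
   below likewise for [tau]. *)
- apply: (@not_universally_definable _ _ _ p q).
    by rewrite /sigma pq.1 ltxx.
  by move=> l; apply: lambda_embed_tau.
- apply: (@not_universally_definable _ _ _ p q).
    by rewrite /tau pq.1 ltxx.
  by move=> l; apply: lambda_embed_sigma.
Qed.
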